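(* Let $\{C_r: r\in\mathbb{Q}\cap[0,1]\}$ be a collection of Cantor sets in $(0,1]$ such that, for $r>s$, $C_r\subsetneq C_s$ and no point of $C_r$ is an endpoint of $C_s$. Let $f:[0,1]\to[0,1]$ be a continuous function such that $f(t)=0$ for all $t\in\{0\}\cup C_0$, $f(t)<\min C_0$ for all $t\in[0,1]$, and $f(t)<t$ for all $t\in(0,1]$. Define $F:[0,1]\to 2^{[0,1]}$ by $F(t)=\{f(t)\}$ if $t\notin C_0$ and $F(t)=[0,\sup\{r\in\mathbb{Q}\cap[0,1]: t\in C_r\}]$ if $t\in C_0$. Then: (i) $F$ is upper semicontinuous, surjective, has the intermediate value property, and has periodic cycles of period $n$ for every $n\in\mathbb{N}$; (ii) $F$ is not almost nonfissile, and $F$ is light if and only if $f$ is light; (iii) the graph $G(F)$ has empty interior (in $[0,1]^2$).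
   Context: $\omega=\{0,1,2,\dots\}$ and $\mathbb{N}=\{1,2,\dots\}$. A set $C\subseteq[0,1]$ is a Cantor set if it is nonempty, closed, perfect and nowhere dense. A point $x\in C$ is a left endpoint of $C$ if there is $a<x$ with $(a,x)\subseteq[0,1]\setminus C$, and a right endpoint of $C$ if there is $a>x$ with $(x,a)\subseteq[0,1]\setminus C$; an endpoint is a left or right endpoint. $2^{[0,1]}$ is the collection of nonempty compact subsets of $[0,1]$. For $F:[0,1]\to 2^{[0,1]}$, the graph is $G(F)=\{(x,y)\in[0,1]^2: y\in F(x)\}$. $F$ is upper semicontinuous if for every $x$ and every open set $U\supseteq F(x)$ there is an open set $V\ni x$ (open in the domain) such that $F(y)\subseteq U$ for all $y\in V$. $F$ is surjective if for every $y\in[0,1]$ there is $x$ with $y\in F(x)$. $F$ is light if for every $y\in[0,1]$ the set $\{x\in[0,1]: y\in F(x)\}$ has empty interior; a single-valued function $f$ is light if $t\mapsto\{f(t)\}$ is light. $F$ has the intermediate value property if, given distinct $x_1,x_2$ and distinct $y_1\in F(x_1)$, $y_2\in F(x_2)$, for every $y$ strictly between $y_1$ and $y_2$ there is some $x$ strictly between $x_1$ and $x_2$ with $y\in F(x)$. An orbit of $F$ is a sequence $\{x_i\}_{i\in\omega}$ with $x_{i+1}\in F(x_i)$ for all $i$. It is periodic if there is $n\in\mathbb{N}$ with $x_{n+i}=x_i$ for all $i$; the smallest such $n$ is its period. A finite sequence $(x_0,\dots,x_{n-1})$ is a (periodic) cycle if $(x_0,\dots,x_{n-1},x_0,\dots,x_{n-1},\dots)$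 is a periodic orbit; the cycle has period $n$ if this orbit has period $n$. A point $(x,y)\in G(F)$ is a nonfissile point of $G(F)$ if $F(x)=\{y\}$, i.e. $|F(x)|=1$. $F$ is almost nonfissile if the set of nonfissile points of $G(F)$ is a dense $G_\delta$ subset of $G(F)$. *)

(* Defs.v *)
From mathcomp Require Import all_boot all_order all_algebra.
From mathcomp Require Import all_classical all_reals all_analysis.
From mathcomp Require Import borel_hierarchy.
Import Order.TTheory GRing.Theory Num.Theory.
Import numFieldNormedType.Exports.

Set Implicit Arguments.
Unset Strict Implicit.
Unset Printing Implicit Defensive.

Local Open Scope classical_set_scope.
Local Open Scope ring_scope.

(* As a type, [I01 R] carries the topology induced from [R]; its elements are
   compared through the inclusion [val] into [R]. *)
Definition I01 (R : realType) : set R := `[0, 1]%classic.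
Arguments I01 R _ : clear implicits.

Definition nowhere_dense (T : topologicalType) (A : set T) : Prop :=
  interior (closure A) = set0.

Definition cantor_set (R : realType) (C : set (I01 R)) : Prop :=
  [/\ C !=set0, closed C, perfect_set C & nowhere_dense C].

Definition left_endpoint (R : realType) (C : set (I01 R)) (x : I01 R) : Prop :=
  C x /\ exists2 a : R, a < val x &
    `]a, val x[%classic `<=` I01 R `\` (val @` C).

Definition right_endpoint (R : realType) (C : set (I01 R)) (x : I01 R) : Prop :=
  C x /\ exists2 a : R, val x < a &
    `]val x, a[%classic `<=` I01 R `\` (val @` C).

Definition endpoint (R : realType) (C : set (I01 R)) (x : I01 R) : Prop :=
  left_endpoint C x \/ right_endpoint C x.

Definition is_min (R : realType) (A : set (I01 R)) (m : I01 R) : Prop :=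
  A m /\ forall a : I01 R, A a -> val m <= val a.

(* [hyperspace T] is $2^T$. *)
Record hyperspace (T : topologicalType) : Type := Hyperspace {
  hset :> set T;
  hset_neq0 : hset !=set0;
  hset_compact : compact hset }.

Definition hsingleton (T : topologicalType) (x : T) : hyperspace T :=
  @Hyperspace T [set x] (ex_intro _ x erefl) (@compact_set1 T x).

Section SetValued.
Context {T : topologicalType}.
Implicit Type F : T -> hyperspace T.

Definition sv_graph F : set (T * T) := [set p | hset (F p.1) p.2].

Definition upper_semicontinuous F : Prop :=
  forall (x : T) (U : set T), open U -> hset (F x) `<=` U ->
    exists V : set T,
      [/\ open V, V x & forall y, V y -> hset (F y) `<=` U].

Definition surjective_sv F : Prop := forall y, exists x, hset (F x) y.

Definition light_sv F : Prop :=
  forall y, interior [set x | hset (F x) y] = set0.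

Definition light (f : T -> T) : Prop := light_sv (fun t => hsingleton (f t)).

Definition sv_orbit F (x : nat -> T) : Prop := forall i, hset (F (x i)) (x i.+1).

Definition repeats (x : nat -> T) (n : nat) : Prop :=
  (0 < n)%N /\ forall i, x (n + i)%N = x i.

Definition periodic_orbit F (x : nat -> T) : Prop :=
  sv_orbit F x /\ exists n, repeats x n.

Definition has_period (x : nat -> T) (n : nat) : Prop :=
  repeats x n /\ forall m, repeats x m -> (n <= m)%N.

(* Nonempty finite sequences; [inZp i : 'I_k.+1] is [i] modulo [k.+1]. *)
Definition repeated (k : nat) (c : k.+1.-tuple T) : nat -> T :=
  fun i => tnth c (inZp i).

Definition sv_cycle (k : nat) F (c : k.+1.-tuple T) : Prop :=
  periodic_orbit F (repeated c).

Definition has_cycle_of_period F (n : nat) : Prop :=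
  exists (k : nat) (c : k.+1.-tuple T),
    sv_cycle F c /\ has_period (repeated c) n.

Definition nonfissile F : set (T * T) :=
  [set p | sv_graph F p /\ hset (F p.1) = [set p.2]].

(* Density and [Gdelta] are taken in the subspace topology of the graph. *)
Definition almost_nonfissile F : Prop :=
  let N : set (sv_graph F) := [set p | nonfissile F (val p)] in
  dense N /\ Gdelta N.

End SetValued.

Definition strictly_between (R : realType) (a b x : I01 R) : Prop :=
  val a < val x < val b \/ val b < val x < val a.

Definition intermediate_value_property (R : realType)
    (F : I01 R -> hyperspace (I01 R)) : Prop :=
  forall x1 x2 y1 y2 : I01 R, x1 <> x2 -> y1 <> y2 ->
    hset (F x1) y1 -> hset (F x2) y2 ->
    forall y, strictly_between y1 y2 y ->
      exists2 x, strictly_between x1 x2 x & hset (F x) y.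

Section InitialSegment.
Context {R : realType}.

Lemma I01_ge0 : I01 R 0. Proof. by rewrite /I01 /= in_itv /= lexx ler01. Qed.

Definition segment0 (s : R) : set (I01 R) := val @^-1` `[0, s]%classic.

Lemma segment0_neq0 (s : R) : 0 <= s -> segment0 s !=set0.
Proof.
move=> s0; exists (SigSub (mem_set I01_ge0)).
by rewrite /segment0 /= in_itv /= lexx.
Qed.

Lemma segment0_compact (s : R) : compact (segment0 s).
Proof.
have cK : compact (`[0, s]%classic `&` I01 R).
  by apply: compact_closedI; [exact: segment_compact | exact: interval_closed].
move=> G PG Gs.
have sK : segment0 s `<=` val @^-1` (`[0, s]%classic `&` I01 R).
  by move=> x xs; split => //; exact: (set_valP x).
have : (fmap val G) (`[0, s]%classic `&` I01 R) by exact: (filterS sK Gs).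
move=> /cK[p [[ps Ip] clp]].
exists (SigSub (mem_set Ip)); split => // A B GA.
case=> _ [] [W oW <-] /= Wp sWB.
have AvA : A `<=` val @^-1` (val @` A) by move=> x Ax; exists x.
have GvA : (fmap val G) (val @` A) by exact: (filterS AvA GA).
have [_ [[x Ax <-] Wx]] := clp _ W GvA (open_nbhs_nbhs (conj oW Wp)).
by exists x; split => //; exact: sWB.
Qed.

Definition hsegment0 (s : R) (s0 : 0 <= s) : hyperspace (I01 R) :=
  Hyperspace (segment0_neq0 s0) (@segment0_compact s).

Definition level (C : rat -> set (I01 R)) (t : I01 R) : R :=
  sup [set ratr r | r in [set r : rat | 0 <= r <= 1 /\ C r t]].

Lemma level_ge0 (C : rat -> set (I01 R)) (t : I01 R) : 0 <= level C t.
Proof.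
rewrite /level; set A := (X in sup X).
have [A0|/set0P[_ [r [/andP[r0 r1] Cr] _]]] := eqVneq A set0;
  first by rewrite A0 sup0.
apply: (@le_trans _ _ (ratr r)); first by rewrite ler0q.
apply: ub_le_sup; last by exists r; rewrite /= ?r0 ?r1.
by exists 1 => _ [q [/andP[_ q1] _] <-]; rewrite -(rmorph1 (@ratr R)) ler_rat.
Qed.

Definition cantor_sv (C : rat -> set (I01 R)) (f : I01 R -> I01 R) (t : I01 R) :
    hyperspace (I01 R) :=
  if t \in C 0 then hsegment0 (level_ge0 C t) else hsingleton (f t).

End InitialSegment.

(* Main.v *)
Require Import Defs.
From mathcomp Require Import all_boot all_order all_algebra.
From mathcomp Require Import all_classical all_reals all_analysis.
From mathcomp Require Import borel_hierarchy.
From mathcomp Require Import lra.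
Import Order.TTheory GRing.Theory Num.Theory.
Import numFieldNormedType.Exports.

Set Implicit Arguments.
Unset Strict Implicit.
Unset Printing Implicit Defensive.

Local Open Scope classical_set_scope.
Local Open Scope ring_scope.

(** Write F for [cantor_sv C f]. Since f vanishes on C_0, f is a selection of F
    ([cantor_sv_selection]), and F differs from f only on the closed nowhere
    dense set C_0, where F(t) is the segment from 0 to the level of t. Membership
    in C_r forces the level to be at least r, and levels above r force
    membership in C_r; this translates all statements about F into statements
    about the sets C_r.

    Upper semicontinuity at a point t of C_0 of level below 1: an open set that
    contains [0, level t] contains [0, r] for some rational r slightly larger
    than the level; then t is not in the closed set C_r, and off C_r the values
    of F are in [0, r] or are values of the continuous function f
    ([cantor_sv_usc]).

    Intermediate values: let y lie between y1 < y2, with y1 in F(x1) and y2 in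
    F(x2). If y2 is in a segment F(x2), then x2 lies in some C_r with r > y;
    for a rational s with y < s < r, the point x2 is not an endpoint of C_s, so
    C_s meets the open interval between x1 and x2, and F contains y at every
    point of C_s. Otherwise y2 = f(x2), while f(x1) <= y1 because f is the least
    selection of F, so the intermediate value theorem for f applies
    ([cantor_sv_ivp]).

    Every value of F on C_1 is the whole interval, so F is surjective, and any n
    distinct points of the infinite set C_1 form a cycle of period n
    ([cantor_sv_cycle]).

    A nonfissile point lies on the graph of the selection f, whereas the
    relatively open part of the graph of F strictly above the graph of f is
    nonempty, since it contains (t, 1) for t in C_1
    ([cantor_sv_not_nonfissile]). Finally, lightness of F reduces to that of f,
    and an open box in the graph of F to one in the graph of f, because a
    nonempty open set cannot be contained in C_0 ([cantor_sv_light],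
    [cantor_sv_graph_interior]). *)

(** * Perfect sets *)

(** If A were finite, A minus a point x would be closed, and its complement
    would be a neighbourhood of x showing that x is isolated in A. *)
Lemma perfect_infinite (T : topologicalType) (A : set T) :
  accessible_space T -> perfect_set A -> A !=set0 -> infinite_set A.
Proof.
move=> T1 [_ limA] [x Ax] finA.
have clAx : closed (A `\ x).
  by move/accessible_finite_set_closed: T1; apply; exact: finite_setD.
have : limit_point A x by rewrite limA.
move=> /(_ (~` (A `\ x)))[|y [yx Ay]]; last by apply; split => //; apply/eqP.
by apply: open_nbhs_nbhs; split; [exact: closed_openC | case=> _; apply].
Qed.

(** * The unit interval as a subspace of the line *)

Section UnitInterval.
Context {R : realType}.
Implicit Types (x y : I01 R) (t : R).

Lemma val_I01_itv x : 0 <= val x <= 1.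
Proof. by have := set_valP x; rewrite /I01 /= in_itv. Qed.

Lemma I01_surj t : 0 <= t <= 1 -> exists x : I01 R, val x = t.
Proof.
move=> t01; have It : I01 R t by rewrite /I01 /= in_itv.
by exists (SigSub (mem_set It)).
Qed.

Lemma val_I01_continuous : continuous (val : I01 R -> R).
Proof. exact: (@initial_continuous (I01 R) R val). Qed.

Lemma I01_accessible : accessible_space (I01 R).
Proof.
move=> x y xy; exists (val @^-1` (~` [set val y])); split.
- apply: open_comp => [z _|]; first exact: val_I01_continuous.
  by apply: closed_openC; apply: accessible_closed_set1;
    exact: hausdorff_accessible (@norm_hausdorff R R).
- by rewrite inE /=; apply/eqP; rewrite (inj_eq val_inj).
- by rewrite !inE /=; apply.
Qed.

Lemma itv01_near (x e : R) : 0 <= x <= 1 -> 0 < e ->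
  exists t : R, [/\ 0 <= t <= 1, t != x & `|x - t| < e].
Proof.
move=> /andP[x0 x1] e0; have [xlt1|xge1] := ltP x 1.
  exists (x + Num.min (e / 2) (1 - x)).
  rewrite opprD addrA subrr add0r normrN.
  by case: (leP (e / 2) (1 - x)) => h;
    (split; [lra | apply/eqP => ?; lra | rewrite ger0_norm; lra]).
exists (x - Num.min (e / 2) 1).
rewrite opprB addrCA subrr addr0.
by case: (leP (e / 2) 1) => h;
  (split; [lra | apply/eqP => ?; lra | rewrite ger0_norm; lra]).
Qed.

(** This is used on a vertical slice of an open subset of a graph. *)
Lemma I01_no_open_singleton x : ~ open [set x].
Proof.
case=> W oW Wx.
have Wvx : W (val x) by have : (val @^-1` W) x by rewrite Wx.
have /nbhs_ballP[e /= e0 eW] : nbhs (val x) W by exact: open_nbhs_nbhs.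
have x01 := val_I01_itv x.
suff [t [t01 tx te]] : exists t : R,
    [/\ 0 <= t <= 1, t != val x & `|val x - t| < e].
  have [y yt] := I01_surj t01.
  have : (val @^-1` W) y by rewrite /= yt; exact: eW.
  by rewrite Wx => /= yx; rewrite -yt yx eqxx in tx.
exact: itv01_near.
Qed.

(** The intermediate value theorem on the line is applied to the extension of f
    by its endpoint values, that is, to f composed with the retraction [clip] of
    the line onto the unit interval. The bounds on t are strict, which keeps the
    solution away from the two ends. *)
Lemma IVT_I01 (f : I01 R -> I01 R) (a b : I01 R) t : continuous f ->
  Num.min (val (f a)) (val (f b)) < t < Num.max (val (f a)) (val (f b)) ->
  exists2 x, strictly_between a b x & val (f x) = t.
Proof.
move=> fc.
wlog ab : a b / val a <= val b => [wl|].
  have [/wl//|/ltW/wl ba] := leP (val a) (val b).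
  rewrite minC maxC => /ba[x xba fx]; exists x => //.
  by case: xba; [right|left].
move=> ft.
have clip_itv (u : R) : I01 R (Num.max 0 (Num.min u 1)).
  by rewrite /I01 /= in_itv /= le_max lexx ge_max ler01 ge_min lexx orbT.
pose clip (u : R) : I01 R := SigSub (mem_set (clip_itv u)).
have clipK (x : I01 R) : clip (val x) = x.
  apply/val_inj => /=; have /andP[x0 x1] := val_I01_itv x.
  by rewrite (min_idPl x1) (max_idPr x0).
have clip_cont : continuous clip.
  apply: continuous_comp_initial => u /=.
  apply: (@continuous_max R R (cst 0) (fun v => Num.min v 1)); first exact: cvg_cst.
  by apply: (@continuous_min R R id (cst 1)); [exact: cvg_id | exact: cvg_cst].
have g_cont : continuous (fun u => val (f (clip u))).
  move=> u; apply: (continuous_comp (f := f \o clip)).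
    by apply: continuous_comp; [exact: clip_cont | exact: fc].
  exact: val_I01_continuous.
have [||u uab gu] := IVT (f := fun u => val (f (clip u))) (v := t) ab.
- exact: continuous_subspaceT.
- by rewrite !clipK; case/andP: ft => /ltW -> /ltW ->.
exists (clip u) => //.
have u01 : 0 <= u <= 1.
  move: uab; rewrite in_itv /= => /andP[au ub].
  have /andP[a0 _] := val_I01_itv a; have /andP[_ b1] := val_I01_itv b.
  by rewrite (le_trans a0 au) (le_trans ub b1).
have cu : val (clip u) = u by have [x <-] := I01_surj u01; rewrite clipK.
have not_strict (p q : R) : Num.min p q < p < Num.max p q -> False.
  by case: (leP p q) => _ /andP[]; rewrite ltxx.
have ua : u != val a.
  by apply/eqP => ua; move: ft; rewrite -gu ua clipK => /not_strict.
have ub : u != val b.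
  by apply/eqP => ub; move: ft; rewrite -gu ub clipK minC maxC => /not_strict.
by left; rewrite cu; move: uab; rewrite in_itv /= !lt_neqAle ub eq_sym ua.
Qed.

End UnitInterval.

(** * The level function *)

Section Level.
Context {R : realType}.
Context (C : rat -> set (I01 R)).
Implicit Types t : I01 R.

Let levels t : set R := [set ratr r | r in [set r : rat | 0 <= r <= 1 /\ C r t]].

Let levels_le1 t : ubound (levels t) 1.
Proof. by move=> _ [q [/andP[_ q1] _] <-]; rewrite -(rmorph1 (@ratr R)) ler_rat. Qed.

Lemma level_ge t (r : rat) : 0 <= r <= 1 -> C r t -> ratr r <= level C t.
Proof.
by move=> r01 Crt; apply: ub_le_sup; [exists 1; exact: levels_le1 | exists r].
Qed.

Lemma level_le t (x : R) : 0 <= x ->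
  (forall r : rat, 0 <= r <= 1 -> C r t -> ratr r <= x) -> level C t <= x.
Proof.
move=> x0 Cx; rewrite /level -/(levels t).
have [->|/set0P A0] := eqVneq (levels t) set0; first by rewrite sup0.
by apply: ge_sup => // _ [r [r01 Crt] <-]; exact: Cx.
Qed.

Lemma level_gt t (x : R) : 0 <= x -> x < level C t ->
  exists r : rat, [/\ 0 <= r <= 1, C r t & x < ratr r].
Proof.
move=> x0 xt; apply: contrapT => nr.
suff : level C t <= x by rewrite leNgt xt.
apply: level_le => // r r01 Crt; rewrite leNgt; apply/negP => xr.
by apply: nr; exists r.
Qed.

End Level.

(** * The set-valued function *)

Section CantorFunction.
Context {R : realType} (C : rat -> set (I01 R)) (f : I01 R -> I01 R).
Context (C_anti : forall r s : rat, 0 <= r <= 1 -> 0 <= s <= 1 -> s <= r ->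
  C r `<=` C s).
Context (f_zero : forall t : I01 R, C 0 t -> val (f t) = 0).
Local Notation F := (cantor_sv C f).
Implicit Types t x y : I01 R.

Lemma cantor_svP t y :
  hset (F t) y <-> (C 0 t /\ val y <= level C t) \/ (~ C 0 t /\ y = f t).
Proof.
rewrite /cantor_sv; case: ifPn => [/set_mem Ct|/negP Ct] /=.
  rewrite /segment0 /= in_itv /=; have /andP[-> _] /= := val_I01_itv y.
  by split => [|[[]|[]//]//]; left.
split => [->|[[Ct' _]|[_ ->]]] //; first by right; split => // /mem_set.
by case: Ct; exact: mem_set.
Qed.

Lemma cantor_sv_level t y (r : rat) : 0 <= r <= 1 -> C r t -> val y <= ratr r ->
  hset (F t) y.
Proof.
move=> r01 Crt yr; apply/cantor_svP; left; split.
  by apply: (C_anti r01) Crt; [by [] | by case/andP: r01].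
exact: le_trans yr (level_ge r01 Crt).
Qed.

Lemma cantor_sv_full t y : C 1 t -> hset (F t) y.
Proof.
move=> C1t; apply: (cantor_sv_level (r := 1)) => //.
by rewrite rmorph1; have /andP[] := val_I01_itv y.
Qed.

(** On C_0, f vanishes and every segment contains 0. *)
Lemma cantor_sv_selection t : hset (F t) (f t).
Proof.
apply/cantor_svP; have [Ct|Ct] := pselect (C 0 t); last by right.
by left; split => //; rewrite f_zero // level_ge0.
Qed.

(** The neighbourhood of t is the complement of C_0 or of some C_r with r above
    the level of t, cut down by the continuity of f. At level 1 the value is the
    whole interval, and no such r exists. *)
Lemma cantor_sv_usc : (forall r, 0 <= r <= 1 -> closed (C r)) ->
  continuous f -> upper_semicontinuous F.
Proof.
move=> C_closed f_cont t U oU FU.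
have oV (r : rat) : 0 <= r <= 1 -> open (~` C r `&` f @^-1` U).
  move=> r01; apply: openI; first by apply: closed_openC; exact: C_closed.
  by apply: open_comp.
have fU : U (f t) by apply: FU; exact: cantor_sv_selection.
have [Ct|Ct] := pselect (C 0 t); last first.
  exists (~` C 0 `&` f @^-1` U); split => //; first exact: oV.
  by move=> y [Cy fy] z /cantor_svP[[]//|[_ ->]].
have [lt1|le1] := ltP (level C t) 1; last first.
  exists setT; split => //; first exact: openT.
  move=> y _ z _; apply/FU/cantor_svP; left; split => //.
  by apply: le_trans le1; have /andP[] := val_I01_itv z.
have [p pt] : exists p : I01 R, val p = level C t.
  by apply: I01_surj; rewrite level_ge0 ltW.
have Up : U p by apply/FU/cantor_svP; left; rewrite pt.
case: oU => W oW WU.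
have : W (level C t) by rewrite -pt; move: Up; rewrite -WU.
move=> /(conj oW)/open_nbhs_nbhs/nbhs_ballP[e /= e0 eW].
(* The open set U contains [0, level t + e), so any r in between will do. *)
have [r] : exists q : rat, ratr q \in `]level C t, Num.min 1 (level C t + e)[.
  by apply: rat_in_itvoo; rewrite lt_min lt1 ltrDl e0.
rewrite in_itv /= lt_min => /andP[tr /andP[r1 re]].
have r0 : 0 < ratr r :> R by apply: le_lt_trans tr; exact: level_ge0.
have r01 : 0 <= r <= 1.
  by move: (ltW r0) (ltW r1); rewrite ler0q -(rmorph1 (@ratr R)) ler_rat => -> ->.
have segU y : val y <= ratr r -> U y.
  move=> yr; have [yt|ty] := leP (val y) (level C t).
    by apply/FU/cantor_svP; left.
  rewrite -WU; apply: eW => /=; rewrite /ball /= distrC ger0_norm ?subr_ge0 ?(ltW ty) //.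
  by rewrite ltrBlDl; exact: le_lt_trans re.
exists (~` C r `&` f @^-1` U); split => //; first exact: oV.
  split => // Crt; have := level_ge r01 Crt; by rewrite leNgt tr.
move=> y [nCy fy] z /cantor_svP[[Cy zy]|[_ ->]] //.
apply: segU; apply: le_trans zy _; apply: level_le => [|q q01 Cqy]; first exact: ltW.
rewrite ler_rat leNgt; apply/negP => rq; apply: nCy.
by apply: C_anti Cqy => //; exact: ltW.
Qed.

(** Two sources of intermediate values: the sets C_s accumulate at x2 from the
    side of x1 because x2 is not an endpoint of C_s, and f itself is continuous.
    Only the larger of the two values decides which source is used. *)
Lemma cantor_sv_ivp : (forall r s : rat, 0 <= r <= 1 -> 0 <= s <= 1 -> s < r ->
    forall t, C r t -> ~ endpoint (C s) t) ->
  continuous f -> intermediate_value_property F.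
Proof.
move=> C_endpoint f_cont x1 x2 y1 y2 x12 _ F1 F2 y.
wlog y12 : x1 x2 y1 y2 x12 F1 F2 / val y1 < val y2 => [wl|].
  case=> /andP[y1y yy2].
    by apply: (wl x1 x2 y1 y2) => //; [exact: lt_trans yy2 | left; rewrite y1y].
  have [||x xx Fx] := wl x2 x1 y2 y1 (nesym x12) F2 F1.
  - exact: lt_trans yy2.
  - by left; rewrite y1y.
  by exists x => //; case: xx; [right|left].
case=> /andP[y1y yy2]; last first.
  by have := lt_trans y12 (lt_trans y1y yy2); rewrite ltxx.
have y0 : 0 <= val y by have /andP[] := val_I01_itv y.
(* f is the least selection of F. *)
have f_le x z : hset (F x) z -> val (f x) <= val z.
  by case/cantor_svP => [[/f_zero -> _]|[_ ->]//]; have /andP[] := val_I01_itv z.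
case/cantor_svP: F2 => [[Cx2 y2x2]|[nCx2 y2E]].
  have [r [r01 Crx2 yr]] := level_gt y0 (lt_le_trans yy2 y2x2).
  have [s] := rat_in_itvoo yr; rewrite in_itv /= => /andP[ys].
  rewrite ltr_rat => sr.
  have s01 : 0 <= s <= 1.
    case/andP: r01 => _ r1; rewrite (le_trans (ltW sr) r1) andbT.
    by rewrite -(ler0q R) (le_trans y0 (ltW ys)).
  have Csx2 : C s x2 by apply: C_anti Crx2 => //; exact: ltW.
  have [z zC xz] : exists2 z, C s z & strictly_between x1 x2 z.
    apply: contrapT => nz; apply: (C_endpoint _ _ r01 s01 sr _ Crx2).
    have gap u : 0 <= u <= 1 -> (val x1 < u < val x2 \/ val x2 < u < val x1) ->
        (I01 R `\` (val @` C s)) u.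
      move=> u01 ux; split; first by rewrite /I01 /= in_itv.
      by case=> z Cz zu; apply: nz; exists z => //; rewrite /strictly_between zu.
    have /andP[x10 x11] := val_I01_itv x1; have /andP[x20 x21] := val_I01_itv x2.
    have : val x1 != val x2 by apply/eqP => /val_inj.
    rewrite neq_lt => /orP[x12'|x12'].
      left; split => //; exists (val x1) => // u /=; rewrite in_itv /= => ux.
      apply: gap; last by left.
      by case/andP: ux => /ltW/(le_trans x10) -> /ltW/le_trans ->.
    right; split => //; exists (val x1) => // u /=; rewrite in_itv /= => ux.
    apply: gap; last by right.
    by case/andP: ux => /ltW/(le_trans x20) -> /ltW/le_trans ->.
  by exists z => //; apply: cantor_sv_level zC _ => //; exact: ltW.
(* The value y2 is now f(x2), while f(x1) <= y1: y lies between values of f. *)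
have fx1y : val (f x1) < val y by exact: le_lt_trans (f_le _ _ F1) y1y.
have [||z xz fz] := IVT_I01 (f := f) (a := x1) (b := x2) (t := val y) => //.
  by rewrite gt_min lt_max fx1y -y2E yy2 orbT.
exists z => //; move/val_inj: fz => <-; exact: cantor_sv_selection.
Qed.

(** Every point of the interval is a successor of every point of C_1, so a
    sequence of points of C_1 is an orbit in whatever order it is run through;
    injectivity rules out shorter periods. *)
Lemma cantor_sv_cycle : infinite_set (C 1) ->
  forall n : nat, (0 < n)%N -> has_cycle_of_period F n.
Proof.
move=> /infiniteP/card_leP[g] [//|k] _.
pose q (i : nat) : I01 R := val (g (to_setT i)).
have q_C i : C 1 (q i) by exact: (set_valP (g (to_setT i))).
have q_inj : injective q.
  move=> i j /val_inj g_ij.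
  by have /(congr1 val) := 'inj_g (in_setT _) (in_setT _) g_ij.
exists k, [tuple of mkseq q k.+1].
have repE i : repeated [tuple of mkseq q k.+1] i = q (i %% k.+1)%N.
  by rewrite /repeated (tnth_nth (q 0%N)) nth_mkseq //= ltn_mod.
have rep : repeats (repeated [tuple of mkseq q k.+1]) k.+1.
  by split => // i; rewrite !repE modnDl.
split; first split.
- by move=> i; apply: cantor_sv_full; rewrite repE; exact: q_C.
- by exists k.+1.
- split => // m [m0 /(_ 0%N)]; rewrite !repE addn0 mod0n => /q_inj m_mod.
  by apply: dvdn_leq => //; apply/eqP.
Qed.

(** The density fails: a nonfissile point is on the graph of the selection f,
    hence outside the relatively open set D of points of the graph strictly
    above the graph of f. *)
Lemma cantor_sv_not_nonfissile : continuous f -> C 1 !=set0 ->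
  ~ almost_nonfissile F.
Proof.
move=> f_cont [t C1t] [+ _].
pose D := [set p : I01 R * I01 R | val (f p.1) < val p.2].
have oD : open D.
  have -> : D = (fun p => val p.2 - val (f p.1)) @^-1` [set u | 0 < u].
    by apply/seteqP; split=> p /=; rewrite subr_gt0.
  have val2 : continuous (fun p : I01 R * I01 R => (val p.2 : R)).
    by move=> p; apply: continuous_comp; [exact: cvg_snd | exact: val_I01_continuous].
  have valf1 : continuous (fun p : I01 R * I01 R => (val (f p.1) : R)).
    move=> p; apply: (continuous_comp (f := f \o fst)); last exact: val_I01_continuous.
    by apply: continuous_comp; [exact: cvg_fst | exact: f_cont].
  apply: open_comp; last exact: open_gt.
  by move=> p _; apply: cvgB; [exact: val2 | exact: valf1].
have [one one1] : exists x : I01 R, val x = 1 by apply: I01_surj; rewrite ler01 lexx.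
have graph_t : sv_graph F (t, one) by exact: cantor_sv_full.
pose O : set (sv_graph F) := val @^-1` D.
have Ot : O (SigSub (mem_set graph_t)).
  rewrite /O /D /= one1 f_zero ?ltr01 //.
  exact: (C_anti (r := 1)) C1t.
move=> /(_ O)[||x [Dx [_ Fx]]].
- by exists (SigSub (mem_set graph_t)).
- by exists D.
- have := cantor_sv_selection (val x).1; rewrite Fx => /= fx.
  by move: Dx; rewrite /O /D /= fx ltxx.
Qed.

(** One direction holds for any selection. For the other, the fibres of F and f
    over y agree outside C_0, so the interior of the fibre of F would have to be
    contained in the nowhere dense set C_0. *)
Lemma cantor_sv_light : closed (C 0) -> nowhere_dense (C 0) ->
  light_sv F <-> light f.
Proof.
move=> C0_closed C0_nd; split => light_ y; apply/seteqP; split => // x.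
- move=> Ux; rewrite -(light_ y); apply: interiorS Ux => z /= ->.
  exact: cantor_sv_selection.
- set S := [set x | _]; move=> Sx.
  have SC : interior S `<=` C 0.
    move=> z Sz; apply: contrapT => nCz.
    suff : interior [set x | hset (hsingleton (f x)) y] z by rewrite light_.
    apply: (@filterS _ _ _ (interior S `\` C 0)).
      by move=> w [/interior_subset/cantor_svP[[]//|[_]]].
    apply: open_nbhs_nbhs; split => //.
    by apply: openI; [exact: open_interior | exact: closed_openC].
  suff : interior (closure (C 0)) x by rewrite C0_nd.
  by apply: filterS (nbhs_interior Sx) => w /SC/subset_closure.
Qed.

(** An open box in the graph contains a vertical slice over a point a outside
    C_0, where F is single-valued; its open side would then be the singleton of
    f(a). *)
Lemma cantor_sv_graph_interior : closed (C 0) -> nowhere_dense (C 0) ->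
  interior (sv_graph F) = set0.
Proof.
move=> C0_closed C0_nd; apply/seteqP; split => // -[x y] [[A B] /= [nA nB] AB].
have [a Aa nCa] : exists2 a, A a & ~ C 0 a.
  apply: contrapT => nA'; suff : interior (closure (C 0)) x by rewrite C0_nd.
  apply: filterS nA => a Aa; apply: subset_closure.
  by apply: contrapT => nCa; apply: nA'; exists a.
have BE : B `<=` [set f a].
  by move=> b Bb; have /cantor_svP[[]//|[_ ->]] : hset (F a) b by exact: (AB (a, b)).
have yfa : y = f a by apply: BE; exact: nbhs_singleton.
apply: (@I01_no_open_singleton _ (f a)).
have <- : interior B = [set f a]; last exact: open_interior.
apply/seteqP; split; first by apply: subset_trans BE; exact: interior_subset.
by move=> _ ->; rewrite -yfa; exact: nB.
Qed.

End CantorFunction.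

Theorem theorem3p5 (R : realType) (C : rat -> set (I01 R))
  (f : I01 R -> I01 R) (m : I01 R)
  (C_cantor : forall r : rat, 0 <= r <= 1 -> cantor_set (C r))
  (C_pos : forall r : rat, 0 <= r <= 1 -> forall t : I01 R, C r t -> 0 < val t)
  (C_proper : forall r s : rat, 0 <= r <= 1 -> 0 <= s <= 1 -> s < r ->
    C r `<` C s)
  (C_endpoint : forall r s : rat, 0 <= r <= 1 -> 0 <= s <= 1 -> s < r ->
    forall t : I01 R, C r t -> ~ endpoint (C s) t)
  (f_cont : continuous f)
  (f_zero : forall t : I01 R, val t = 0 \/ C 0 t -> val (f t) = 0)
  (m_min : is_min (C 0) m)
  (f_lt_min : forall t : I01 R, val (f t) < val m)
  (f_lt : forall t : I01 R, 0 < val t -> val (f t) < val t) :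
  let F := cantor_sv C f in
  [/\ upper_semicontinuous F,
      surjective_sv F,
      intermediate_value_property F &
      forall n : nat, (0 < n)%N -> has_cycle_of_period F n] /\
  (~ almost_nonfissile F /\ (light_sv F <-> light f)) /\
  interior (sv_graph F) = set0.
Proof.
move=> F.
have C_anti (r s : rat) : 0 <= r <= 1 -> 0 <= s <= 1 -> s <= r -> C r `<=` C s.
  move=> r01 s01; rewrite le_eqVlt => /orP[/eqP -> //|sr].
  exact: (properW (C_proper _ _ r01 s01 sr)).
have f_zero0 t : C 0 t -> val (f t) = 0 by move=> Ct; apply: f_zero; right.
have i0 : 0 <= (0 : rat) <= 1 by [].
have i1 : 0 <= (1 : rat) <= 1 by [].
have [_ C0_closed _ C0_nd] := C_cantor 0 i0.
have [C1_neq0 _ C1_perfect _] := C_cantor 1 i1.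
have C_closed r : 0 <= r <= 1 -> closed (C r) by move=> /C_cantor[].
split; [|split; [split|]].
- split.
  + exact: cantor_sv_usc.
  + by case: C1_neq0 => x C1x y; exists x; exact: cantor_sv_full.
  + exact: cantor_sv_ivp.
  + apply: cantor_sv_cycle => //.
    by apply: perfect_infinite => //; exact: I01_accessible.
- exact: cantor_sv_not_nonfissile.
- exact: cantor_sv_light.
- exact: cantor_sv_graph_interior.
Qed.
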